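(* Let $r$ be the number of maximal equal-letter runs in the Burrows-Wheeler transform of a string $T$. Then $T$ has a string attractor of size $r$.
   Context: A string attractor of a string $T$ of length $n$ is a set $\Gamma\subseteq\{1,\dots,n\}$ such that every substring $T[i..j]$ has an occurrence $T[i'..j']=T[i..j]$ with $p\in[i',j']$ for some $p\in\Gamma$. It is assumed that $T[n]=\$$, a symbol not occurring elsewhere in $T$ and lexicographically smaller than all other symbols. The suffix array $SA$ of $T$ is the permutation of $[1..n]$ listing starting positions of suffixes in lexicographic order; the Burrows-Wheeler transform is $BWT[i]=T[SA[i]-1]$ if $SA[i]>1$ and $\$$ otherwise (equivalently, the last column of the lexicographically sorted matrix of cyclic rotations of $T$). *)

(* Defs.v *)
From HB Require Import structures.
From mathcomp Require Import all_boot all_order.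

Set Implicit Arguments.
Unset Strict Implicit.
Unset Printing Implicit Defensive.

(* All positions are 0-based: position k here is position k + 1 in the usual
   1-based indexing of strings. *)

Section Substrings.
Variable A : eqType.
Implicit Types (T s : seq A).

(* T[i..j], both ends included; meaningful for i <= j < size T. *)
Definition substring T (i j : nat) : seq A := take (j.+1 - i) (drop i T).

Definition string_attractor T (G : {set 'I_(size T)}) : Prop :=
  forall i j : 'I_(size T), i <= j ->
  exists i' j' p : 'I_(size T),
    [/\ substring T i' j' = substring T i j, p \in G & i' <= p <= j'].

Definition equal_letter_run s (i j : nat) : bool :=
  [&& i <= j, j < size s & constant (substring s i j)].

Definition maximal_run s (i j : 'I_(size s)) : bool :=
  equal_letter_run s i j &&
  [forall i' : 'I_(size s), forall j' : 'I_(size s),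
     [&& i' <= i, j <= j' & equal_letter_run s i' j'] ==>
     (i' == i) && (j' == j)].

Definition num_runs s : nat :=
  #|[set ij : 'I_(size s) * 'I_(size s) | maximal_run ij.1 ij.2]|.

End Substrings.

Section BurrowsWheeler.
Variables (disp : Order.disp_t) (A : orderType disp).
Implicit Types (T : seq A) (dollar : A).

Definition dollar_terminated dollar T : Prop :=
  (exists2 s : seq A, T = rcons s dollar & dollar \notin s) /\
  (forall a : A, a != dollar -> (dollar < a)%O).

Definition suffix_le T (i j : nat) : bool :=
  ((drop i T : seqlexi A) <= (drop j T : seqlexi A))%O.

Definition suffix_array T : seq nat := sort (suffix_le T) (iota 0 (size T)).

Definition bwt dollar T : seq A :=
  [seq if 0 < k then nth dollar T k.-1 else dollar | k <- suffix_array T].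

End BurrowsWheeler.

(* Main.v *)
Require Import Defs.
From HB Require Import structures.
From mathcomp Require Import all_boot all_order.

Set Implicit Arguments.
Unset Strict Implicit.
Unset Printing Implicit Defensive.

Import Order.TTheory.

(** The attractor consists of the text positions of the letters that start a
    run of the Burrows-Wheeler transform.  Given a nonempty word [w] occurring
    in the text, let [i] be its occurrence whose suffix comes first in the
    suffix array.  If [i] is not in the attractor, the suffix just before the
    one at [i.+1] in the suffix array is also preceded by the first letter of
    [w], so it cannot start with the tail of [w].  Hence the tail is nonempty
    and [i.+1] is its first occurrence in the suffix array, and the argument
    repeats until an attractor position is met inside the occurrence of [w] at
    [i]. *)

Section Substrings.
Variables (A : eqType) (x0 : A).
Implicit Types (T w : seq A).

Lemma size_substring T i j : j < size T -> size (substring T i j) = j.+1 - i.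
Proof. by move=> lt_j; rewrite size_takel // size_drop leq_sub2r. Qed.

Lemma nth_substring T i j k :
  k < j.+1 - i -> nth x0 (substring T i j) k = nth x0 T (i + k).
Proof. by move=> lt_k; rewrite nth_take // nth_drop. Qed.

Definition occurrence T w (i : nat) : bool := prefix w (drop i T).

Lemma occurrence_substring T i j : occurrence T (substring T i j) i.
Proof. exact: prefix_take. Qed.

Lemma occurrence_cons T c w i :
  i < size T ->
  occurrence T (c :: w) i = (c == nth x0 T i) && occurrence T w i.+1.
Proof. by move=> lt_i; rewrite /occurrence (drop_nth x0 lt_i) prefix_cons. Qed.

Lemma occurrence_leq_size T w i :
  w != [::] -> occurrence T w i -> i + size w <= size T.
Proof.
rewrite -size_eq0 -lt0n => w_gt0 /size_prefix; rewrite size_drop => le_w.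
by rewrite -leq_subRL // ltnW // -subn_gt0 (leq_trans w_gt0).
Qed.

Lemma substring_occurrence T w i :
  w != [::] -> occurrence T w i -> substring T i (i + size w).-1 = w.
Proof.
rewrite -size_eq0 -lt0n /occurrence prefixE => w_gt0 /eqP {2}<-.
by rewrite /substring prednK ?addn_gt0 ?w_gt0 ?orbT // addKn.
Qed.

Lemma string_attractor_occurrence T (G : {set 'I_(size T)}) :
  (forall w i, w != [::] -> occurrence T w i ->
     exists (i' : nat) (p : 'I_(size T)),
       [/\ occurrence T w i', p \in G & i' <= p < i' + size w]) ->
  string_attractor G.
Proof.
move=> coverG i j le_ij; set w := substring T i j.
have w_gt0 : 0 < size w by rewrite size_substring // subn_gt0.
have w_neq0 : w != [::] by rewrite -size_eq0 -lt0n.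
have [i' [p [occ_i' pG /andP[le_i'p lt_p]]]] :=
  coverG w i w_neq0 (occurrence_substring T i j).
have e_gt0 : 0 < i' + size w by rewrite addn_gt0 w_gt0 orbT.
have lt_e : (i' + size w).-1 < size T by rewrite prednK // occurrence_leq_size.
exists (Ordinal (leq_ltn_trans le_i'p (ltn_ord p))), (Ordinal lt_e), p.
by split=> //=; rewrite ?substring_occurrence // le_i'p -ltnS prednK.
Qed.

End Substrings.

Section Runs.
Variables (A : eqType) (x0 : A).
Implicit Types (s : seq A).

Lemma constant_nthP s :
  reflect (forall k, k < size s -> nth x0 s k = nth x0 s 0) (constant s).
Proof.
case: s => [|x s]; first by constructor.
apply: (iffP (all_nthP x0)) => /= eq_x => [[|k] // lt_k | k lt_k].
  exact/eqP/eq_x.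
exact/eqP/(eq_x k.+1).
Qed.

Lemma equal_letter_runP s i j :
  reflect [/\ i <= j, j < size s &
             forall k, i <= k <= j -> nth x0 s k = nth x0 s i]
          (equal_letter_run s i j).
Proof.
apply: (iffP and3P) => -[le_ij lt_j run_ij]; split=> //.
  move=> k /andP[le_ik le_kj]; have := constant_nthP _ run_ij (k - i).
  rewrite size_substring // !nth_substring ?subn_gt0 ?ltn_sub2rE ?subnKC //.
  by rewrite addn0; apply; rewrite ltnS.
apply/constant_nthP => k; rewrite size_substring // => lt_k.
rewrite !nth_substring ?subn_gt0 // addn0 run_ij // leq_addr /=.
by rewrite -ltnS -ltn_subRL.
Qed.

Lemma equal_letter_run_id s i : i < size s -> equal_letter_run s i i.
Proof.
move=> lt_i; apply/equal_letter_runP; split=> // k.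
by rewrite -eqn_leq => /eqP->.
Qed.

Lemma equal_letter_runS s i j :
  nth x0 s i = nth x0 s i.+1 -> equal_letter_run s i.+1 j ->
  equal_letter_run s i j.
Proof.
move=> eq_i /equal_letter_runP[lt_ij lt_j run_ij].
apply/equal_letter_runP; split=> // [|k /andP[]]; first exact: ltnW.
by rewrite leq_eqVlt => /predU1P[-> // | lt_ik le_kj]; rewrite run_ij ?lt_ik.
Qed.

Lemma maximal_runP s (i j : 'I_(size s)) :
  reflect (equal_letter_run s i j /\
           forall i' j' : nat, i' <= i -> j <= j' -> equal_letter_run s i' j' ->
             i' = i /\ j' = j)
          (maximal_run i j).
Proof.
apply: (iffP andP) => -[run_ij max_ij]; split=> //.
  move=> i' j' le_i' le_j' run'; have [le' lt_j' _] := and3P run'.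
  move: max_ij => /forallP/(_ (Ordinal (leq_ltn_trans le' lt_j'))).
  move=> /forallP/(_ (Ordinal lt_j'))/implyP/=; rewrite le_i' le_j' run'.
  by move=> /(_ isT)/andP[/eqP<- /eqP<-].
apply/forallP=> i'; apply/forallP=> j'; apply/implyP=> /and3P[le_i' le_j' run'].
by have [/val_inj-> /val_inj->] := max_ij _ _ le_i' le_j' run'; rewrite !eqxx.
Qed.

Definition run_start s (i : nat) : bool :=
  (i == 0) || (nth x0 s i.-1 != nth x0 s i).

Lemma maximal_run_start s (i j : 'I_(size s)) :
  maximal_run i j -> run_start s i.
Proof.
move=> /maximal_runP[]; case: i => -[|i] // lt_i /= run_ij max_ij.
apply/negP=> /eqP eq_i; have run'_ij := equal_letter_runS eq_i run_ij.
by have [/n_Sn] := max_ij i j (leqnSn i) (leqnn j) run'_ij.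
Qed.

Lemma equal_letter_run_startF s i j k :
  equal_letter_run s i j -> i < k <= j -> run_start s k = false.
Proof.
case: k => // k /equal_letter_runP[_ _ run_ij].
rewrite ltnS => /andP[le_ik lt_kj].
by rewrite /run_start /= !run_ij ?eqxx ?le_ik ?(leqW le_ik) ?(ltnW lt_kj).
Qed.

Lemma run_start_ex_maximal_run s (i : 'I_(size s)) :
  run_start s i -> exists j : 'I_(size s), maximal_run i j.
Proof.
move=> start_i.
case: (@arg_maxnP _ i (fun j : 'I__ => equal_letter_run s i j) val) => [|j].
  exact: equal_letter_run_id.
move=> run_ij max_j; exists j.
apply/maximal_runP; split=> // i' j' le_i' le_j' run'.
have [_ lt_j' _] := and3P run'; have [le_ij _ _] := and3P run_ij.
have eq_i' : i' = i.
  apply/eqP; rewrite eqn_leq le_i' leqNgt; apply: contraL start_i => lt_i'.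
  by rewrite (equal_letter_run_startF run') // lt_i' (leq_trans le_ij).
split=> //; apply/eqP; rewrite eqn_leq le_j' andbT.
by apply: (max_j (Ordinal lt_j')); rewrite /= -eq_i'.
Qed.

Lemma maximal_run_end_uniq s (i j j' : 'I_(size s)) :
  maximal_run i j -> maximal_run i j' -> j = j'.
Proof.
move=> /maximal_runP[run_ij max_j] /maximal_runP[run_ij' max_j'].
apply: val_inj; case: (leqP j j') => [le_j|/ltnW le_j].
  by have [] := max_j i j' (leqnn i) le_j run_ij'.
by have [] := max_j' i j (leqnn i) le_j run_ij.
Qed.

Lemma num_runsE s : num_runs s = #|[set i : 'I_(size s) | run_start s i]|.
Proof.
rewrite /num_runs; set M := [set ij | _].
suff -> : [set i : 'I_(size s) | run_start s i] = fst @: M.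
  rewrite card_in_imset // => -[i j] [i' j']; rewrite !inE /= => run run' eq_i.
  by rewrite -{}eq_i in run' *; rewrite (maximal_run_end_uniq run run').
apply/setP=> i; rewrite inE; apply/idP/imsetP.
  by case/run_start_ex_maximal_run=> j run; exists (i, j); rewrite ?inE.
by case=> -[i' j]; rewrite inE /= => /maximal_run_start start ->.
Qed.

End Runs.

Lemma prefix_lexi_convex (disp disp' : Order.disp_t) (A : porderType disp)
    (w : seq A) (s t u : seqlexi_with disp' A) :
  prefix w s -> prefix w u -> (s <= t)%O -> (t <= u)%O -> prefix w t.
Proof.
elim: w s t u => [|c w IHw] [|x s] [|y t] [|z u] //; rewrite ?prefix0s //.
rewrite !prefix_cons => /andP[/eqP<- ws] /andP[/eqP<- wu].
rewrite !lexi_cons => /andP[le_cy le_st] /andP[le_yc le_tu].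
have /eqP eq_cy : c == y by rewrite eq_le le_cy le_yc.
by rewrite -eq_cy lexx in le_st le_tu *; rewrite eqxx (IHw s t u).
Qed.

Section SuffixArray.
Variables (disp : Order.disp_t) (A : orderType disp) (T : seq A).
Implicit Types (w : seq A).

Local Notation SA := (suffix_array T).

Lemma suffix_le_refl : reflexive (suffix_le T).
Proof. by move=> i; apply: lexx. Qed.

Lemma suffix_le_trans : transitive (suffix_le T).
Proof. by move=> j i k; apply: le_trans. Qed.

Lemma suffix_le_total : total (suffix_le T).
Proof. by move=> i j; apply: le_total. Qed.

Lemma suffix_le_anti i j : i < size T -> j < size T ->
  suffix_le T i j -> suffix_le T j i -> i = j.
Proof.
move=> lt_i lt_j le_ij le_ji.
have /(congr1 size) : drop i T = drop j T.
  by apply: (@le_anti _ (seqlexi A)); apply/andP.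
rewrite !size_drop => eq_ij.
by rewrite -(subKn (ltnW lt_i)) eq_ij (subKn (ltnW lt_j)).
Qed.

Lemma suffix_leS x0 i j : i < size T -> j < size T ->
  nth x0 T i = nth x0 T j -> suffix_le T i j = suffix_le T i.+1 j.+1.
Proof.
move=> lt_i lt_j eq_ij.
rewrite /suffix_le (drop_nth x0 lt_i) (drop_nth x0 lt_j) eq_ij.
by rewrite lexi_cons lexx.
Qed.

Lemma occurrence_convex w i j k : suffix_le T i j -> suffix_le T j k ->
  occurrence T w i -> occurrence T w k -> occurrence T w j.
Proof.
move=> le_ij le_jk occ_i occ_k.
exact: prefix_lexi_convex occ_i occ_k le_ij le_jk.
Qed.

Lemma size_suffix_array : size SA = size T.
Proof. by rewrite size_sort size_iota. Qed.

Lemma mem_suffix_array i : (i \in SA) = (i < size T).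
Proof. by rewrite mem_sort mem_iota. Qed.

Lemma suffix_array_uniq : uniq SA.
Proof. by rewrite sort_uniq iota_uniq. Qed.

Lemma nth_suffix_array_lt k : k < size T -> nth 0 SA k < size T.
Proof.
by move=> lt_k; rewrite -mem_suffix_array mem_nth ?size_suffix_array.
Qed.

Lemma nth_suffix_array_eq a b : a < size T -> b < size T ->
  (nth 0 SA a == nth 0 SA b) = (a == b).
Proof.
move=> lt_a lt_b; rewrite nth_uniq ?size_suffix_array //.
exact: suffix_array_uniq.
Qed.

Lemma nth_suffix_array_surj i :
  i < size T -> exists2 k, k < size T & nth 0 SA k = i.
Proof. by rewrite -mem_suffix_array -size_suffix_array => /(nthP 0). Qed.

Lemma nth_suffix_array_le a b : a <= b -> b < size T ->
  suffix_le T (nth 0 SA a) (nth 0 SA b).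
Proof.
move=> le_ab lt_b.
apply: (sorted_leq_nth suffix_le_trans suffix_le_refl) => //.
- exact/sort_sorted/suffix_le_total.
- by rewrite inE size_suffix_array (leq_ltn_trans le_ab).
- by rewrite inE size_suffix_array.
Qed.

Definition first_occurrence w (i : nat) : Prop :=
  occurrence T w i /\
  forall k, k < size T -> occurrence T w k -> suffix_le T i k.

Lemma ex_first_occurrence w i : i < size T -> occurrence T w i ->
  exists i' : 'I_(size T), first_occurrence w i'.
Proof.
move=> lt_i occ_i.
case: (@arg_minP _ _ _ (Ordinal lt_i)
         (fun k : 'I__ => occurrence T w k)
         (fun k : 'I__ => drop k T : seqlexi A) occ_i) => i' occ_i' min_i'.
by exists i'; split=> // k lt_k; apply: (min_i' (Ordinal lt_k)).
Qed.

Lemma first_occurrence_nth w k : k.+1 < size T ->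
    ~~ occurrence T w (nth 0 SA k) -> occurrence T w (nth 0 SA k.+1) ->
  first_occurrence w (nth 0 SA k.+1).
Proof.
move=> lt_k1 noccur_k occ_k1; split=> // m.
case/nth_suffix_array_surj=> a lt_a <- occ_a.
apply: nth_suffix_array_le => //; rewrite ltnNge.
apply: contra noccur_k => le_ak; apply: occurrence_convex occ_a occ_k1.
  by rewrite nth_suffix_array_le ?(ltnW lt_k1).
by rewrite nth_suffix_array_le.
Qed.

(* Since [p] and [i] carry the same letter, [p] also precedes [i] in the
   suffix array, so it cannot be an occurrence of [c :: w]; hence the row
   before that of [i.+1] is not an occurrence of [w]. *)
Lemma first_occurrence_behead x0 c w k p i :
    k.+1 < size T -> nth 0 SA k = p.+1 -> nth 0 SA k.+1 = i.+1 ->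
    nth x0 T p = nth x0 T i -> first_occurrence (c :: w) i ->
  w != [::] /\ first_occurrence w i.+1.
Proof.
move=> lt_k1 SAk SAk1 eq_pi [occ_i min_i]; have lt_k := ltnW lt_k1.
have lt_i : i < size T by rewrite ltnW // -SAk1 nth_suffix_array_lt.
have lt_p : p < size T by rewrite ltnW // -SAk nth_suffix_array_lt.
move: occ_i; rewrite (occurrence_cons x0) // => /andP[/eqP c_i occ_i1].
have le_pi : suffix_le T p i.
  by rewrite (suffix_leS lt_p lt_i eq_pi) -SAk -SAk1 nth_suffix_array_le.
have noccur_p1 : ~~ occurrence T w p.+1.
  apply/negP=> occ_p1; have le_ip : suffix_le T i p.
    by apply: min_i; rewrite // (occurrence_cons x0) // eq_pi c_i eqxx.
  have := nth_suffix_array_eq lt_k lt_k1.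
  by rewrite SAk SAk1 (suffix_le_anti lt_p lt_i le_pi le_ip) eqxx ltn_eqF.
split; first by apply: contraNneq noccur_p1 => ->; apply: prefix0s.
by rewrite -SAk1; apply: first_occurrence_nth; rewrite ?SAk ?SAk1.
Qed.

End SuffixArray.

Section Attractor.
Variables (disp : Order.disp_t) (A : orderType disp) (dollar : A) (T : seq A).
Hypothesis T_dollar : dollar_terminated dollar T.

Local Notation SA := (suffix_array T).
Local Notation BWT := (bwt dollar T).

Lemma size_bwt : size BWT = size T.
Proof. by rewrite size_map size_suffix_array. Qed.

Lemma nth_bwt k p :
  k < size T -> nth 0 SA k = p.+1 -> nth dollar BWT k = nth dollar T p.
Proof. by move=> lt_k SAk; rewrite (nth_map 0) ?size_suffix_array // SAk. Qed.

(* Out of range, [nth] also returns [dollar]. *)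
Lemma nth_eq_dollar k : (nth dollar T k == dollar) = (size T <= k.+1).
Proof.
have [[s -> dollarNs] _] := T_dollar; rewrite size_rcons ltnS nth_rcons.
case: ltnP => [lt_k|_]; last by rewrite if_same eqxx.
by apply: contraNF dollarNs => /eqP <-; rewrite mem_nth.
Qed.

Lemma nth_bwt_eq_dollar k :
  k < size T -> (nth dollar BWT k == dollar) = (nth 0 SA k == 0).
Proof.
move=> lt_k; rewrite (nth_map 0) ?size_suffix_array //.
case SAk: (nth 0 SA k) => [|p]; first by rewrite !eqxx.
by rewrite nth_eq_dollar leqNgt -SAk nth_suffix_array_lt // SAk.
Qed.

(* The letter [dollar] occurs only once in the transform, so two rows ending
   with the same letter both start at a positive position. *)
Lemma nth_bwt_eq a b : a < size T -> b < size T -> a != b ->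
    nth dollar BWT a = nth dollar BWT b ->
  exists p q, [/\ nth 0 SA a = p.+1, nth 0 SA b = q.+1 &
                  nth dollar T p = nth dollar T q].
Proof.
move=> lt_a lt_b; rewrite -(nth_suffix_array_eq lt_a lt_b) => neq_ab eq_ab.
have := nth_bwt_eq_dollar lt_a; rewrite eq_ab nth_bwt_eq_dollar //.
case SAa: (nth 0 SA a) neq_ab => [|p]; case SAb: (nth 0 SA b) => [|q] // _ _.
by exists p, q; split=> //; rewrite -(nth_bwt lt_a SAa) -(nth_bwt lt_b SAb).
Qed.

Lemma bwt_row_subproof (p : 'I_(size T)) : index (ordS p : nat) SA < size BWT.
Proof.
have lt_p := ltn_ord (ordS p).
by rewrite size_bwt -[ltnRHS]size_suffix_array index_mem mem_suffix_array.
Qed.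

(* The row of the sorted matrix of rotations whose last letter is the one at
   position [p] of the text; the rotation starts at [p.+1], cyclically. *)
Definition bwt_row (p : 'I_(size T)) : 'I_(size BWT) :=
  Ordinal (bwt_row_subproof p).

Lemma nth_bwt_row p : nth 0 SA (bwt_row p) = ordS p.
Proof. by rewrite nth_index // mem_suffix_array ltn_ord. Qed.

Lemma bwt_row_bij : bijective bwt_row.
Proof.
apply: inj_card_bij; last by rewrite !card_ord size_bwt.
by move=> p q eq_pq; apply/ordS_inj/ord_inj; rewrite -!nth_bwt_row eq_pq.
Qed.

Definition run_start_positions : {set 'I_(size T)} :=
  bwt_row @^-1: [set k : 'I_(size BWT) | run_start dollar BWT k].

Lemma card_run_start_positions : #|run_start_positions| = num_runs BWT.
Proof.
by rewrite (num_runsE dollar) on_card_preimset //; apply/onW_bij/bwt_row_bij.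
Qed.

Lemma run_start_positionsN (i : 'I_(size T)) : i \notin run_start_positions ->
  exists k p, [/\ k.+1 < size T, nth 0 SA k = p.+1, nth 0 SA k.+1 = i.+1 &
                  nth dollar T p = nth dollar T i].
Proof.
rewrite !inE negb_or negbK -lt0n => /andP[].
have := nth_bwt_row i; have := ltn_ord (bwt_row i); rewrite [ltnRHS]size_bwt.
case: (val (bwt_row i)) => // k lt_k1 SAk1 _ /eqP/= eq_letter.
have neq_k : k != k.+1 by rewrite neq_ltn ltnSn.
have [p [q [SAk SAk1q eq_pq]]] := nth_bwt_eq (ltnW lt_k1) lt_k1 neq_k eq_letter.
suff eq_qi : q = i by exists k, p; rewrite -eq_qi.
move: SAk1; rewrite SAk1q /=; have := ltn_ord i; rewrite leq_eqVlt.
by case/predU1P=> [-> | lt_i1]; rewrite ?modnn // modn_small // => -[].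
Qed.

Lemma first_occurrence_has_run_start w i :
    w != [::] -> i < size T -> first_occurrence T w i ->
  exists2 p : 'I_(size T), p \in run_start_positions & i <= p < i + size w.
Proof.
elim: w i => // c w IHw i _ lt_i first_i; rewrite /= addnS.
have [iG | iNG] := boolP (Ordinal lt_i \in run_start_positions).
  by exists (Ordinal lt_i); rewrite //= leqnn ltnS leq_addr.
have [k [p [lt_k1 SAk SAk1 eq_pi]]] := run_start_positionsN iNG.
have lt_i1 : i.+1 < size T by rewrite -SAk1 nth_suffix_array_lt.
have [w_neq0 first_i1] := first_occurrence_behead lt_k1 SAk SAk1 eq_pi first_i.
have [m mG] := IHw _ w_neq0 lt_i1 first_i1.
by rewrite addSn => /andP[lt_im le_m]; exists m; rewrite // (ltnW lt_im).
Qed.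

Lemma run_start_positions_attractor : string_attractor run_start_positions.
Proof.
apply: string_attractor_occurrence => w i w_neq0 occ_i.
have lt_i : i < size T.
  apply: leq_trans (occurrence_leq_size w_neq0 occ_i).
  by rewrite -[ltnLHS]addn0 ltn_add2l lt0n size_eq0.
have [i' first_i'] := ex_first_occurrence lt_i occ_i.
have [p pG p_in_w] :=
  first_occurrence_has_run_start w_neq0 (ltn_ord i') first_i'.
by exists i', p; split=> //; case: first_i'.
Qed.

End Attractor.

Theorem theorem3p9 (disp : Order.disp_t) (A : orderType disp)
    (dollar : A) (T : seq A) (hT : dollar_terminated dollar T) :
  exists G : {set 'I_(size T)},
    string_attractor G /\ #|G| = num_runs (bwt dollar T).
Proof.
exists (run_start_positions dollar T); split.
  exact: run_start_positions_attractor.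
exact: card_run_start_positions.
Qed.
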